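(* For every square matrix $A \in \mathbb{R}^{n \times n}$, \[ \rho_{\mathrm{per}}(A) + \eta_{\mathrm{per}}(A) \geq n . \]
   Context: The permanent of an $m\times m$ matrix $B=(b_{ij})$ is $\mathrm{per}(B)=\sum_{\sigma\in S_m}\prod_{i=1}^m b_{i,\sigma(i)}$. The permanental polynomial of $A\in\mathbb{R}^{n\times n}$ is $\pi(A,x)=\mathrm{per}(A-xI)$, where $I$ is the $n\times n$ identity. The permanental rank $\rho_{\mathrm{per}}(A)$ is the largest integer $k$ such that $A$ has a $k\times k$ submatrix $A[I,J]$ (rows indexed by $I$, columns by $J$, $|I|=|J|=k$, not necessarily $I=J$) with nonzero permanent. The permanental nullity $\eta_{\mathrm{per}}(A)$ is the multiplicity of $0$ as a root of $\pi(A,x)$. *)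

(* Defs.v *)
From HB Require Import structures.
From mathcomp Require Import all_boot all_order all_fingroup all_algebra.
From mathcomp Require Import boolp reals.

Set Implicit Arguments.
Unset Strict Implicit.
Unset Printing Implicit Defensive.

Import GRing.Theory.
Local Open Scope ring_scope.

Definition per (R : comNzRingType) (m : nat) (B : 'M[R]_m) : R :=
  \sum_(s : 'S_m) \prod_(i < m) B i (s i).

Definition per_poly (R : comNzRingType) (n : nat) (A : 'M[R]_n) : {poly R} :=
  per (map_mx polyC A - 'X%:M).

(* [enum_val] lists the elements of a set of ordinals in increasing order. *)
Definition submx_set (R : Type) (m n : nat) (A : 'M[R]_(m, n))
    (I : {set 'I_m}) (J : {set 'I_n}) : 'M[R]_(#|I|, #|J|) :=
  mxsub (@enum_val _ (mem I)) (@enum_val _ (mem J)) A.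

Definition has_nonzero_subper (R : comNzRingType) (n : nat) (A : 'M[R]_n)
    (k : nat) : Prop :=
  exists (I J : {set 'I_n}) (cardI : #|I| = k) (cardJ : #|J| = k),
    per (castmx (cardI, cardJ) (submx_set A I J)) != 0.

(* The range of the maximum loses nothing, by [has_nonzero_subper_leq], and is
   never empty, by [has_nonzero_subper0]. *)
Definition per_rank (R : comNzRingType) (n : nat) (A : 'M[R]_n) : nat :=
  \max_(k < n.+1 | `[< has_nonzero_subper A k >]) k.

Definition per_nullity (R : fieldType) (n : nat) (A : 'M[R]_n) : nat :=
  mup 0 (per_poly A).

Lemma has_nonzero_subper_leq (R : comNzRingType) (n : nat) (A : 'M[R]_n) k :
  has_nonzero_subper A k -> (k <= n)%N.
Proof.
by move=> [I [_ [cardI _]]]; rewrite -cardI -[n in (_ <= n)%N]card_ord max_card.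
Qed.

Lemma has_nonzero_subper0 (R : comNzRingType) (n : nat) (A : 'M[R]_n) :
  has_nonzero_subper A 0.
Proof.
exists set0, set0, (cards0 _), (cards0 _).
rewrite /per (eq_bigr (fun=> 1)); last by move=> s _; rewrite big_ord0.
by rewrite sumr_const card_Sn fact0 oner_neq0.
Qed.

Lemma per_rankP (R : comNzRingType) (n : nat) (A : 'M[R]_n) :
  has_nonzero_subper A (per_rank A) /\
  (forall k, has_nonzero_subper A k -> (k <= per_rank A)%N).
Proof.
split=> [|k kA].
  have P0 : `[< has_nonzero_subper A (@ord0 n) >].
    by apply/asboolP; exact: has_nonzero_subper0.
  rewrite /per_rank (bigmax_eq_arg _ P0) //.
  by case: arg_maxnP => // i /asboolP.
have kn : (k < n.+1)%N by rewrite ltnS (has_nonzero_subper_leq kA).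
exact: (@leq_bigmax_cond _ (fun k : 'I_n.+1 => `[< has_nonzero_subper A k >])
  (fun k => k : nat) (Ordinal kn) (asboolT kA)).
Qed.

(* Main.v *)
Require Import Defs.
From HB Require Import structures.
From mathcomp Require Import all_boot all_order all_fingroup all_algebra.
From mathcomp Require Import boolp reals.

(** Expanding the product over the diagonal gives
    [per (A - x I) = \sum_S (- x)^(n - #|S|) per A[S, S]].
    If [#|S|] exceeds the permanental rank, the term of [S] vanishes; hence
    [x^(n - per_rank A)] divides the permanental polynomial, which is nonzero
    because [S = set0] contributes its leading term [(- x)^n]. *)

Set Implicit Arguments.
Unset Strict Implicit.
Unset Printing Implicit Defensive.

Import GRing.Theory.
Local Open Scope ring_scope.

Section ExtendPerm.

Variables (T : finType) (S : {set T}).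

(** The match on [idP] supplies the proof of [x \in S] that [enum_rank_in] requires, as ['I_#|S|]
    may be empty. *)
Definition extend_fun (t : 'S_#|S|) (x : T) : T :=
  match @idP (x \in S) with
  | ReflectT Sx => enum_val (t (enum_rank_in Sx x))
  | ReflectF _ => x
  end.

Lemma extend_fun_val t (j : 'I_#|S|) :
  extend_fun t (enum_val j) = enum_val (t j).
Proof.
rewrite /extend_fun; case: {-}_ / idP => [Sj|[]]; last exact: enum_valP.
by rewrite enum_valK_in.
Qed.

Lemma extend_fun_out t x : x \notin S -> extend_fun t x = x.
Proof. by move/negP=> Sx; rewrite /extend_fun; case: {-}_ / idP. Qed.

Lemma extend_fun_inj t : injective (extend_fun t).
Proof.
have valS x : x \in S -> exists j : 'I_#|S|, x = enum_val j.
  by move=> Sx; exists (enum_rank_in Sx x); rewrite enum_rankK_in.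
move=> x y; have [/valS[i ->]|Sx] := boolP (x \in S);
  have [/valS[j ->]|Sy] := boolP (y \in S);
  rewrite ?extend_fun_val ?extend_fun_out //.
- by move/enum_val_inj/perm_inj->.
- by move=> eq_y; case/negP: Sy; rewrite -eq_y enum_valP.
- by move=> eq_x; case/negP: Sx; rewrite eq_x enum_valP.
Qed.

Definition extend_perm t : {perm T} := perm (@extend_fun_inj t).

Lemma extend_perm_val t (j : 'I_#|S|) :
  extend_perm t (enum_val j) = enum_val (t j).
Proof. by rewrite permE extend_fun_val. Qed.

Lemma extend_perm_inj : injective extend_perm.
Proof.
move=> s t eq_st; apply/permP=> j; apply: enum_val_inj.
by rewrite -!extend_perm_val eq_st.
Qed.

Lemma extend_perm_on t : perm_on S (extend_perm t).
Proof.
apply/subsetP=> x; apply: contraR => Sx.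
by rewrite permE extend_fun_out.
Qed.

(** One inclusion suffices, since both sets have [#|S|]! elements; no restriction map has to be
    built. *)
Lemma imset_extend_perm :
  extend_perm @: [set: 'S_#|S|] = [set s | perm_on S s].
Proof.
apply/eqP; rewrite eqEcard; apply/andP; split.
  by apply/subsetP=> _ /imsetP[t _ ->]; rewrite inE extend_perm_on.
rewrite card_imset ?cardsT ?card_Sn; last exact: extend_perm_inj.
by rewrite cardsE card_perm.
Qed.

End ExtendPerm.

Section PermanentalPolynomial.

Variables (R : comNzRingType) (n : nat).
Implicit Types (A : 'M[R]_n) (S : {set 'I_n}).

(** Reindexing along [extend_perm] gives the principal minors the shape in which they arise from
    expanding [per_poly]. *)
Lemma per_submx_set A S :
  per (submx_set A S S) = \sum_(s | perm_on S s) \prod_(i in S) A i (s i).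
Proof.
rewrite -(eq_bigl _ _ (fun s => in_set (perm_on S) s)) -imset_extend_perm.
rewrite big_imset /=; last by move=> s t _ _; apply: extend_perm_inj.
apply: eq_big => [s|t _]; first by rewrite inE.
rewrite [RHS]big_enum_val /=; apply: eq_bigr => j _.
by rewrite extend_perm_val mxE.
Qed.

Lemma per_poly_expansion A :
  per_poly A =
  \sum_S (per (submx_set A S S))%:P * (- 'X) ^+ #|~: S|.
Proof.
rewrite /per_poly /per.
under eq_bigr => s _.
  under eq_bigr => i _ do rewrite !mxE.
  (* Here [S] collects the indices [i] whose factor contributes [A i (s i)] rather than the entry of
     [- 'X%:M]. *)
  rewrite bigA_distr /=.
  over.
rewrite exchange_big /=; apply: eq_bigr => S _.
rewrite -/(per _) per_submx_set rmorph_sum /= mulr_suml.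
(* If [s] moves some [i] outside [S], the factor at [i] is an off-diagonal entry of a scalar matrix,
   hence zero. *)
rewrite [LHS](bigID (perm_on S)) /= [X in _ + X]big1 ?addr0; last first.
  move=> s /subsetPn[i si Si]; rewrite (bigD1 i) //= (negbTE Si).
  by rewrite eq_sym; move: si; rewrite inE => /negbTE->; rewrite mulr0n oppr0 mul0r.
apply: eq_bigr => s onS; rewrite (bigID (mem S)) /= rmorph_prod /=.
congr (_ * _); first by apply: eq_bigr => i ->.
rewrite -prodr_const; apply: eq_big => [i|i Si]; first by rewrite inE.
by rewrite (negbTE Si) (out_perm onS) // eqxx mulr1n.
Qed.

Lemma per_submx_set_eq0 A S :
  (per_rank A < #|S|)%N -> per (submx_set A S S) = 0.
Proof.
move=> ltS; apply/eqP; apply: contraTT ltS => nzS; rewrite -leqNgt.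
apply: (proj2 (per_rankP A)); exists S, S, erefl, erefl.
by rewrite castmx_id.
Qed.

Lemma coef_per_poly_n A : (per_poly A)`_n = (-1) ^+ n.
Proof.
rewrite per_poly_expansion coef_sum (bigD1 set0) //= big1 ?addr0 => [|S nzS].
  rewrite setC0 cardsT card_ord -scaleN1r exprZn coefCM coefZ coefXn eqxx mulr1.
  rewrite per_submx_set (eq_bigl (pred1 1%g)) => [|s].
    by rewrite big_pred1_eq big_set0 mul1r.
  apply/idP/eqP => [on0|->]; last exact: perm_on1.
  by apply/permP=> i; rewrite perm1 (out_perm on0) ?inE.
rewrite -scaleN1r exprZn coefCM coefZ coefXn.
(* For nonempty [S] the exponent [n - #|S|] is strictly below [n]; positivity of [n] comes from
   [0 < #|S| <= n]. *)
rewrite (_ : (n == _) = false) ?mulr0 //; apply/gtn_eqF.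
have leSn := max_card (mem S); rewrite -card_gt0 card_ord in nzS leSn.
by rewrite cardsCs setCK card_ord ltn_subrL nzS (leq_trans nzS).
Qed.

Lemma per_poly_neq0 A : per_poly A != 0.
Proof.
apply/eqP=> A0; have /eqP := coef_per_poly_n A.
by rewrite A0 coef0 eq_sym signr_eq0.
Qed.

End PermanentalPolynomial.

Lemma dvdXn_per_poly (F : fieldType) (n : nat) (A : 'M[F]_n) :
  'X ^+ (n - per_rank A) %| per_poly A.
Proof.
rewrite per_poly_expansion.
apply: (big_ind (fun p => 'X ^+ (n - per_rank A) %| p)) => [|p q|S _].
- exact: dvdp0.
- exact: dvdp_add.
(* Either the minor vanishes, or [#|S| <= per_rank A] and the exponent [n - #|S|] is large
   enough. *)
have [/per_submx_set_eq0->|leS] := ltnP (per_rank A) #|S|.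
  by rewrite polyC0 mul0r dvdp0.
rewrite exprNn !dvdp_mull // dvdp_exp2l // cardsCs setCK card_ord.
exact: leq_sub2l.
Qed.

Theorem theorem1 (R : realType) (n : nat) (A : 'M[R]_n) :
  (n <= per_rank A + per_nullity A)%N.
Proof.
(* For a nonzero polynomial, a lower bound on the multiplicity of 0 is divisibility by that power of
   ['X]. *)
rewrite -leq_subLR /per_nullity mup_geq ?per_poly_neq0 //.
by rewrite subr0 dvdXn_per_poly.
Qed.
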